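(* There exists a constant $c>0$ such that for every $n\in\mathbb{N}^*$ and every boolean function $f:\{-1,1\}^n\to\{-1,1\}$, $$Ent(f)\leq c\,\mathbb{E}|\mathcal{S}_f|^2=c\sum_{S\subseteq[n]}|S|^2\hat f(S)^2.$$
   Context: $\{-1,1\}^n$ carries the uniform measure. $\hat f(S)=2^{-n}\sum_x f(x)\prod_{i\in S}x_i$ for $S\subseteq[n]$. The spectrum entropy is $Ent(f)=\sum_{S}\hat f(S)^2\log_2\frac{1}{\hat f(S)^2}$ (terms with $\hat f(S)=0$ being $0$). The spectral sample $\mathcal{S}_f$ is the random subset of $[n]$ with $\mathbb{P}(\mathcal{S}_f=S)=\hat f(S)^2$. *)

(* Defs.v *)
From HB Require Import structures.
From mathcomp Require Import all_boot all_order all_algebra.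
From mathcomp Require Import all_classical all_reals all_analysis.

Set Implicit Arguments.
Unset Strict Implicit.
Unset Printing Implicit Defensive.

Import Order.TTheory GRing.Theory Num.Theory.
Import numFieldNormedType.Exports.

Local Open Scope ring_scope.

(** The two-point set {-1, 1}, as a finite subtype of [int]. *)
Definition spin : finType := seq_sub [:: (-1 : int); 1].

Definition cube (n : nat) : finType := {ffun 'I_n -> spin}.

Definition spin_val (R : realType) (s : spin) : R := (val s)%:~R.

Section Fourier.
Context (R : realType) (n : nat).
Implicit Types (f : cube n -> spin) (S : {set 'I_n}).

Definition walsh S (x : cube n) : R := \prod_(i in S) spin_val R (x i).

Definition fourier f S : R :=
  (2 ^+ n)^-1 * \sum_(x : cube n) spin_val R (f x) * walsh S x.

Definition log2 (x : R) : R := ln x / ln 2.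

(** Since [0 ^+ 2 = 0], a vanishing coefficient contributes 0. *)
Definition spectral_entropy f : R :=
  \sum_(S : {set 'I_n}) fourier f S ^+ 2 * log2 (1 / fourier f S ^+ 2).

Lemma spin_valP (s : spin) : spin_val R s = 1 \/ spin_val R s = - 1.
Proof.
rewrite /spin_val; have := valP s; rewrite /= !inE => /orP[] /eqP -> /=.
  by right.
by left.
Qed.

Lemma spin_val_inj : injective (spin_val R).
Proof. by move=> s t /intr_inj /val_inj. Qed.

Lemma sum_walsh (x y : cube n) :
  \sum_(S : {set 'I_n}) walsh S x * walsh S y = (2 ^+ n) *+ (x == y).
Proof.
have -> : \sum_(S : {set 'I_n}) walsh S x * walsh S y =
    \prod_(i < n) (spin_val R (x i) * spin_val R (y i) + 1).
  rewrite bigA_distr; apply: eq_bigr => S _.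
  by rewrite -big_split /= big_mkcond.
have [<-|/eqP neq_xy] := eqVneq x y.
  rewrite mulr1n -[in RHS](card_ord n) -prodr_const; apply: eq_bigr => i _.
  by case: (spin_valP (x i)) => ->; rewrite ?mulrNN mulr1.
have [i neq_i] : exists i, x i != y i.
  apply/existsP; apply: contra_notT neq_xy => /existsPn eq_xy.
  by apply/ffunP => i; apply/eqP; have := eq_xy i; rewrite negbK.
rewrite mulr0n (bigD1 i) //=.
have : spin_val R (x i) != spin_val R (y i) by rewrite (inj_eq spin_val_inj).
by case: (spin_valP (x i)) => ->; case: (spin_valP (y i)) => ->;
  rewrite ?eqxx // => _; rewrite ?mulN1r ?mulrN1 addNr mul0r.
Qed.

Lemma parseval f : \sum_(S : {set 'I_n}) fourier f S ^+ 2 = 1.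
Proof.
have two_neq0 : (2 ^+ n : R) != 0 by rewrite expf_neq0 ?pnatr_eq0.
under eq_bigr do rewrite exprMn expr2.
rewrite -mulr_sumr.
under eq_bigr => S _.
  rewrite expr2 mulr_suml.
  under eq_bigr do rewrite mulr_sumr.
  over.
rewrite exchange_big /=.
under eq_bigr do rewrite exchange_big /=.
have E x : \sum_(y : cube n) \sum_(S : {set 'I_n})
    spin_val R (f x) * walsh S x * (spin_val R (f y) * walsh S y) = 2 ^+ n.
  under eq_bigr => y _.
    under eq_bigr do rewrite mulrACA.
    rewrite -mulr_sumr sum_walsh.
    over.
  rewrite (bigD1 x) //= eqxx mulr1n big1 ?addr0; last first.
    by move=> y; rewrite eq_sym => /negPf ->; rewrite mulr0n mulr0.
  by case: (spin_valP (f x)) => ->; rewrite ?mulrNN !mul1r.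
under eq_bigr do rewrite E.
rewrite sumr_const card_ffun card_ord card_seq_sub // -[_ *+ (_ ^ _)]mulr_natr natrX.
by rewrite mulrACA mulVf ?mul1r ?mulVf.
Qed.

End Fourier.

HB.instance Definition _ (T : finType) := isPointed.Build {set T} finset.set0.

HB.instance Definition _ (n : nat) := @isMeasurable.Build
  default_measure_display {set 'I_n} discrete_measurable discrete_measurable0
  discrete_measurableC discrete_measurableU.

(** The law of the spectral sample. *)
Definition spectral_sample (R : realType) (n : nat) (f : cube n -> spin)
    (A : set {set 'I_n}) : \bar R :=
  (\sum_(S \in A) (fourier R f S ^+ 2)%:E)%E.

Section SpectralSample.
Local Open Scope classical_set_scope.
Context (R : realType) (n : nat) (f : cube n -> spin).
Local Notation mu := (@spectral_sample R n f).

Let mu0 : mu set0 = 0%E.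
Proof. by rewrite /spectral_sample fsbig_set0. Qed.

Let mu_ge0 A : (0 <= mu A)%E.
Proof.
rewrite /spectral_sample fsbig_finite//= sumEFin lee_fin.
by apply: sumr_ge0 => S _; exact: sqr_ge0.
Qed.

Let mu_esum A : mu A = (\esum_(S in A) (fourier R f S ^+ 2)%:E)%E.
Proof. by rewrite esum_fset//= => S _; rewrite lee_fin sqr_ge0. Qed.

Let mu_sigma_additive : semi_sigma_additive mu.
Proof.
move=> F mF tF mUF; apply: cvg_toP.
  apply: ereal_nondecreasing_is_cvgn => m k mk.
  by apply: lee_sum_nneg_natr => // j _ _; exact: mu_ge0.
rewrite mu_esum nneseries_sum_bigcup//; last first.
  by move=> S; rewrite lee_fin sqr_ge0.
by apply: eq_eseriesr => k _; exact: mu_esum.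
Qed.

HB.instance Definition _ :=
  isMeasure.Build _ _ _ mu mu0 mu_ge0 mu_sigma_additive.

Let mu_setT : mu [set: _] = 1%E.
Proof.
rewrite /spectral_sample fsbig_finite//= sumEFin -(parseval R f); congr (_%:E).
apply: perm_big; apply: uniq_perm.
- exact: finmap.fset_uniq.
- exact: index_enum_uniq.
- move=> S; rewrite in_fset_set; last exact: finite_finset.
  by transitivity true; [exact: mem_set | rewrite mem_index_enum].
Qed.

HB.instance Definition _ := Measure_isProbability.Build _ _ R mu mu_setT.

Lemma spectral_sample1 (S : {set 'I_n}) :
  mu [set S] = (fourier R f S ^+ 2)%:E.
Proof. by rewrite /spectral_sample fsbig_set1. Qed.

End SpectralSample.

(* Main.v *)
(** Let I_i = P(i \in S_f) be the influences.  Comparing the law of S_f with the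
    weights prod_{i in S} I_i, renormalised by e^{- sum_i I_i}, gives
    Ent(f) ln 2 <= sum_i I_i ln (1 / I_i) + sum_i I_i.  Since f is boolean, I_i is
    also the density of the set A_i of inputs at which coordinate i is pivotal, so
    the edge-isoperimetric inequality on the cube bounds I_i log2 (1 / I_i) by the
    normalised edge boundary of A_i.  Flipping a second coordinate j in the
    derivative f(x) - f(x^i) and applying Parseval, the boundary in direction j is
    at most 2 P(i, j \in S_f).  Summing over i and j yields
    sum_i I_i log2 (1 / I_i) <= 2 E|S_f|^2, hence c = 2 + 1 / ln 2. *)
Require Import Defs.
From HB Require Import structures.
From mathcomp Require Import all_boot all_order all_algebra.
From mathcomp Require Import all_classical all_reals all_analysis.
From mathcomp Require Import ring lra.

Import Order.TTheory GRing.Theory Num.Theory.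
Import numFieldNormedType.Exports.

Set Implicit Arguments.
Unset Strict Implicit.
Unset Printing Implicit Defensive.

Local Open Scope ring_scope.

(** * Scalar inequalities for the logarithm *)

Lemma chord_le_ln {R : realType} (u : R) : 0 <= u <= 1 -> u * ln 2 <= ln (1 + u).
Proof.
move=> /andP[u0 u1]; have := concave_ln (Itv01 u0 u1) (ltr0Sn R 1) (ltr01 : 0 < 1 :> R).
rewrite !convRE /= ln1 mulr0 addr0 => /le_trans; apply.
by rewrite le_eqVlt; apply/orP; left; apply/eqP; congr ln; rewrite /unstable.onem; ring.
Qed.

(** Inductive step of edge isoperimetry: [a] and [b] are the sizes of the two halves of a set, and
    at most [2 * b] of its points have their neighbour in the other half. Concavity gives
    [ln (1 + b / a) >= b / a * ln 2], and [(a + b) / b >= 2] gives the rest. *)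
Lemma two_point_ineq {R : realType} (a b : R) : 0 <= b <= a ->
  a * ln a + b * ln b + 2 * b * ln 2 <= (a + b) * ln (a + b).
Proof.
move=> /andP[b0 ba]; have [->|bn0] := eqVneq b 0; first by rewrite !(addr0, mulr0, mul0r).
have bp : 0 < b by rewrite lt_neqAle eq_sym bn0.
have ap : 0 < a := lt_le_trans bp ba.
have an0 : a != 0 by rewrite gt_eqF.
have hr : 0 <= b / a <= 1 by rewrite ler_pdivrMr // mul1r ba divr_ge0 // ltW.
have ha : b * ln 2 <= a * (ln (a + b) - ln a).
  have -> : b * ln 2 = a * (b / a * ln 2) by field.
  rewrite ler_pM2l // (le_trans (chord_le_ln hr))//.
  by rewrite -ln_div ?posrE ?addr_gt0// mulrDl divff.
have hb : b * ln 2 <= b * (ln (a + b) - ln b).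
  rewrite ler_pM2l // -ln_div ?posrE ?addr_gt0//.
  rewrite ler_ln ?posrE ?divr_gt0 ?addr_gt0// ler_pdivlMr//; lra.
lra.
Qed.

(** * Coordinate flips and edge isoperimetry *)

Definition spin_neg (s : spin) : spin := insubd s (- val s).

Lemma val_spin_neg s : val (spin_neg s) = - val s.
Proof.
(* The default value of [insubd] is never returned, since {-1, 1} is closed under negation. *)
rewrite val_insubd /=; case: ifP => // /negP[].
by have := valP s; rewrite /= !inE => /orP[] /eqP ->.
Qed.

Lemma spin_negK : involutive spin_neg.
Proof. by move=> s; apply: val_inj; rewrite !val_spin_neg opprK. Qed.

Lemma spin_neq_neg s t : (s != t) = (s == spin_neg t).
Proof.
rewrite -!val_eqE val_spin_neg.
have := valP s; have := valP t; rewrite /= !inE.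
by move=> /orP[] /eqP -> /orP[] /eqP ->.
Qed.

Lemma spin_val_neg (R : realType) s : spin_val R (spin_neg s) = - spin_val R s.
Proof. by rewrite /spin_val val_spin_neg mulrNz. Qed.

Definition flip {n} (i : 'I_n) (x : cube n) : cube n :=
  [ffun j => if j == i then spin_neg (x j) else x j].

Lemma flipK {n} (i : 'I_n) : involutive (flip i).
Proof. by move=> x; apply/ffunP => j; rewrite !ffunE; case: eqP => //; rewrite spin_negK. Qed.

Lemma sum_flip {V : nmodType} {n} (i : 'I_n) (h : cube n -> V) :
  \sum_x h (flip i x) = \sum_x h x.
Proof. by rewrite [RHS](reindex_inj (inv_inj (flipK i))). Qed.

(** An edge in direction [i] with both ends in [A] is counted twice, once from each end. *)
Definition inner {n} (i : 'I_n) (A : {set cube n}) : {set cube n} :=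
  [set x in A | flip i x \in A].

(** [flip j] changes coordinate [j], so it carries each counted point to the other part; being
    injective, it leaves at most [minn #|A| #|B|] such points in each part. *)
Lemma card_innerU {n} (j : 'I_n) (A B : {set cube n}) (s : spin) :
  (forall x, x \in A -> x j = s) -> (forall x, x \in B -> x j != s) ->
  (#|inner j (A :|: B)| <= 2 * minn #|A| #|B|)%N.
Proof.
move=> As Bs.
have le1 (C D : {set cube n}) : (#|[set x in C | flip j x \in D]| <= minn #|C| #|D|)%N.
  rewrite leq_min; apply/andP; split.
    by apply: subset_leq_card; apply/fintype.subsetP => x; rewrite inE => /andP[].
  rewrite -(card_imset _ (inv_inj (flipK j))); apply: subset_leq_card.
  by apply/fintype.subsetP => _ /imsetP[x + ->]; rewrite inE => /andP[].
have sub : inner j (A :|: B) \subset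
    [set x in A | flip j x \in B] :|: [set x in B | flip j x \in A].
  apply/fintype.subsetP => x; rewrite !inE => /andP[/orP[xA|xB] /orP[fA|fB]].
  - have := As _ fA; rewrite ffunE eqxx (As _ xA) => /eqP.
    by rewrite eq_sym -spin_neq_neg eqxx.
  - by rewrite xA fB.
  - by rewrite xB fA orbT.
  - have := Bs _ fB; rewrite ffunE eqxx spin_neq_neg (inj_eq (inv_inj spin_negK)).
    by move/eqP => e; move: (Bs _ xB); rewrite e eqxx.
apply: leq_trans (subset_leq_card sub) _.
apply: leq_trans (leq_card_setU _ _) _.
by rewrite mul2n -addnn leq_add ?le1// minnC le1.
Qed.

(* Restricting to a list [J] of directions lets the induction on the dimension
   take place inside a fixed cube. *)
Lemma edge_isoperimetry (R : realType) {n} (J : seq 'I_n) (A : {set cube n}) :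
  uniq J -> (\sum_(j <- J) #|inner j A|)%:R * ln 2 <= #|A|%:R * ln #|A|%:R :> R.
Proof.
elim: J A => [|j J IH] A.
  rewrite big_nil mul0r => _; case: (posnP #|A|) => [->|A0]; first by rewrite mul0r.
  by rewrite mulr_ge0 // ln_ge0 // ler1n.
move=> /= /andP[jJ uJ]; rewrite big_cons.
case: (set_0Vmem A) => [->|[x0 _]].
  have e i : inner i finset.set0 = finset.set0 :> {set cube n} by apply/setP => x; rewrite !inE.
  by rewrite e big1 ?cards0 ?mul0r// => i _; rewrite e cards0.
pose B := [set x in A | x j == x0 j]; pose C := [set x in A | x j != x0 j].
have AE : A = B :|: C.
  by apply/setP => x; rewrite !inE -andb_orr orbN andbT.
have disj : [disjoint B & C].
  rewrite -setI_eq0; apply/eqP/setP => x; rewrite !inE.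
  by case: (x j == x0 j); rewrite ?andbF.
have cA : #|A| = (#|B| + #|C|)%N by rewrite AE cardsU disjoint_setI0 // cards0 subn0.
(* For [i != j], flipping [i] keeps coordinate [j], so no edge in direction [i] joins [B] to [C]. *)
have split i : i \in J -> #|inner i A| = (#|inner i B| + #|inner i C|)%N.
  move=> iJ; have ij : (j == i) = false.
    by apply: contraNF jJ => /eqP ->.
  rewrite -(cardsID [set x : cube n | x j == x0 j] (inner i A)); congr addn;
    apply: eq_card => x; rewrite !inE ffunE ij;
    by case: (x j == x0 j); rewrite ?andbF ?andbT.
have inn : (#|inner j A| <= 2 * minn #|B| #|C|)%N.
  rewrite AE; apply: (@card_innerU _ _ _ _ (x0 j)) => x; rewrite !inE.
    by case/andP => _ /eqP.
  by case/andP.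
have -> : (\sum_(i <- J) #|inner i A| =
    \sum_(i <- J) #|inner i B| + \sum_(i <- J) #|inner i C|)%N.
  by rewrite -big_split /=; apply: eq_big_seq => i /split.
have hB := IH B uJ; have hC := IH C uJ.
have hj : #|inner j A|%:R * ln 2 <= 2 * (minn #|B| #|C|)%:R * ln 2 :> R.
  by rewrite ler_pM2r ?ln_gt0 ?ltr1n// -natrM ler_nat.
(* Either half may be the larger one, hence [maxn] and [minn]. *)
have := @two_point_ineq R (maxn #|B| #|C|)%:R (minn #|B| #|C|)%:R.
rewrite ler0n ler_nat geq_min leq_max leqnn /= => /(_ isT).
rewrite cA !natrD; move: hj; case: (leqP #|B| #|C|) => _; last by lra.
by rewrite [#|C|%:R + _]addrC; lra.
Qed.

(** * Fourier coefficients and discrete derivatives *)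

Definition coef {R : realType} {n} (h : cube n -> R) (S : {set 'I_n}) : R :=
  (2 ^+ n)^-1 * \sum_x h x * walsh R S x.

Lemma coefB {R : realType} {n} (g h : cube n -> R) (S : {set 'I_n}) :
  coef (fun x => g x - h x) S = coef g S - coef h S.
Proof.
rewrite /coef -mulrBr -sumrB; congr (_ * _).
by apply: eq_bigr => x _; rewrite mulrBl.
Qed.

Lemma walsh_flip (R : realType) {n} (i : 'I_n) (S : {set 'I_n}) x :
  walsh R S (flip i x) = (-1) ^+ (i \in S) * walsh R S x.
Proof.
rewrite /walsh; have off j : j != i -> spin_val R (flip i x j) = spin_val R (x j).
  by rewrite ffunE => /negPf ->.
have [iS|iS] := boolP (i \in S).
  rewrite !(bigD1 i iS) /= ffunE eqxx spin_val_neg expr1 !mulNr mul1r.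
  by congr (- (_ * _)); apply: eq_bigr => j /andP[_ /off].
rewrite expr0 mul1r; apply: eq_bigr => j jS; apply: off.
by apply: contraNneq iS => <-.
Qed.

Lemma coef_flip {R : realType} {n} (h : cube n -> R) (i : 'I_n) (S : {set 'I_n}) :
  coef (h \o flip i) S = (-1) ^+ (i \in S) * coef h S.
Proof.
rewrite /coef -(sum_flip i) mulrCA; congr (_ * _).
rewrite mulr_sumr; apply: eq_bigr => x _.
by rewrite /= flipK walsh_flip mulrCA.
Qed.

(** Characters without [i] are invariant under the flip and cancel; those with [i] change sign and
    double. *)
Lemma coef_sub_flip {R : realType} {n} (h : cube n -> R) (i : 'I_n) (S : {set 'I_n}) :
  coef (fun x => h x - h (flip i x)) S = 2 * (i \in S)%:R * coef h S.
Proof. by rewrite coefB coef_flip; case: (i \in S); rewrite /=; ring. Qed.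

Lemma parseval_fun {R : realType} {n} (h : cube n -> R) :
  \sum_(S : {set 'I_n}) coef h S ^+ 2 = (2 ^+ n)^-1 * \sum_x h x ^+ 2.
Proof.
have two_neq0 : (2 ^+ n : R) != 0 by rewrite expf_neq0 ?pnatr_eq0.
under eq_bigr => S _.
  rewrite exprMn [(\sum_x _) ^+ 2]expr2 mulr_suml.
  under eq_bigr do rewrite mulr_sumr.
  over.
rewrite -mulr_sumr exchange_big /= expr2 -mulrA; congr (_ * _).
rewrite mulr_sumr; apply: eq_bigr => x _.
rewrite exchange_big /=; under eq_bigr => y _.
  under eq_bigr do rewrite mulrACA.
  rewrite -mulr_sumr sum_walsh.
  over.
rewrite (bigD1 x) //= eqxx mulr1n big1 ?addr0; last first.
  by move=> y; rewrite eq_sym => /negPf ->; rewrite mulr0n mulr0.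
by field.
Qed.

Lemma dirichlet_flip {R : realType} {n} (h : cube n -> R) (i : 'I_n) :
  (2 ^+ n)^-1 * \sum_x (h x - h (flip i x)) ^+ 2 =
  4 * \sum_(S : {set 'I_n} | i \in S) coef h S ^+ 2.
Proof.
rewrite -parseval_fun mulr_sumr [RHS]big_mkcond /=; apply: eq_bigr => S _.
by rewrite coef_sub_flip; case: (i \in S) => /=; ring.
Qed.

(** * Influences and pivotal inputs *)

Definition pivotal {n} (f : cube n -> spin) (i : 'I_n) : {set cube n} :=
  [set x | f x != f (flip i x)].

Definition influence (R : realType) {n} (f : cube n -> spin) (i : 'I_n) : R :=
  \sum_(S : {set 'I_n} | i \in S) fourier R f S ^+ 2.

Lemma spin_diff (R : realType) (s t : spin) :
  (s != t -> (spin_val R s - spin_val R t) ^+ 2 = 4) /\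
  (s = t -> spin_val R s - spin_val R t = 0).
Proof.
split=> [|->]; last by rewrite subrr.
by rewrite spin_neq_neg => /eqP ->; rewrite spin_val_neg;
  case: (spin_valP R t) => ->; ring.
Qed.

(** The squared derivative of [f] is 4 at pivotal inputs and 0 elsewhere; this 4 cancels the one in
    [dirichlet_flip]. *)
Lemma card_pivotal (R : realType) {n} (f : cube n -> spin) (i : 'I_n) :
  #|pivotal f i|%:R = 2 ^+ n * influence R f i.
Proof.
have two_neq0 : (2 ^+ n : R) != 0 by rewrite expf_neq0 ?pnatr_eq0.
have := dirichlet_flip (fun x => spin_val R (f x)) i.
rewrite -[X in _ = 4 * X]/(influence R f i) => e.
apply: (@mulfI _ 4); first by rewrite pnatr_eq0.
rewrite mulrCA -e mulVKf // cardE -sum1_size big_enum /= natr_sum mulr_sumr big_mkcond /=.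
apply: eq_bigr => x _; rewrite inE; have [d s] := spin_diff R (f x) (f (flip i x)).
by case: ifP => [/d -> |/negbFE /eqP /s ->]; rewrite ?mulr1 // expr0n.
Qed.

Lemma card_pivotal_boundary (R : realType) {n} (f : cube n -> spin) (i j : 'I_n) :
  #|pivotal f i :\: inner j (pivotal f i)|%:R <=
  2 * 2 ^+ n * \sum_(S : {set 'I_n} | (i \in S) && (j \in S)) fourier R f S ^+ 2.
Proof.
set A := pivotal f i.
pose g x : R := spin_val R (f x) - spin_val R (f (flip i x)).
have two_gt0 : (0 < 2 ^+ n :> R) by rewrite exprn_gt0.
have gA x : g x ^+ 2 = 4 * (x \in A)%:R.
  have [d s] := spin_diff R (f x) (f (flip i x)); rewrite /g inE.
  by case: eqP => [/s -> |/eqP /d ->] /=; rewrite ?mulr1 // mulr0 expr0n.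
(* [g] is 0 off [A] and +-2 on [A], so each boundary edge contributes 4 to the
   energy of [g], once from each endpoint. *)
pose b x : R := ((x \in A) && (flip j x \notin A))%:R.
have le_b : \sum_x (4 * b x + 4 * b (flip j x)) <= \sum_x (g x - g (flip j x)) ^+ 2.
  apply: ler_sum => x _; rewrite /b flipK.
  have := gA x; have := gA (flip j x).
  case: (x \in A); case: (flip j x \in A) => /= /eqP + /eqP.
  - by move=> _ _; rewrite !mulr0 addr0 sqr_ge0.
  - by rewrite mulr0 sqrf_eq0 => /eqP -> /eqP e; rewrite subr0 e; lra.
  - by rewrite mulr0 sqrf_eq0 => /eqP e /eqP ->; rewrite sub0r sqrrN e; lra.
  - by move=> _ _; rewrite !mulr0 addr0 sqr_ge0.
have sum_b : \sum_x b x = #|A :\: inner j A|%:R.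
  rewrite cardE -sum1_size big_enum /= natr_sum [RHS]big_mkcond /=; apply: eq_bigr => x _.
  by rewrite /b !inE; case: (_ != _); case: (_ != _).
move: le_b; rewrite big_split /= (sum_flip j (fun x => 4 * b x)) -mulr_sumr sum_b.
have -> : \sum_x (g x - g (flip j x)) ^+ 2 =
    2 ^+ n * (4 * \sum_(S : {set 'I_n} | j \in S) coef g S ^+ 2).
  by rewrite -dirichlet_flip mulVKf // gt_eqF.
have -> : \sum_(S : {set 'I_n} | j \in S) coef g S ^+ 2 =
    4 * \sum_(S : {set 'I_n} | (i \in S) && (j \in S)) fourier R f S ^+ 2.
  rewrite mulr_sumr big_mkcond [RHS]big_mkcond; apply: eq_bigr => S _ /=.
  case: (j \in S); last by rewrite andbF.
  rewrite (coef_sub_flip (fun x => spin_val R (f x))) -[coef _ _]/(fourier R f S).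
  by case: (i \in S) => /=; ring.
set X := \sum_(_ | _) _ => h.
(* Each of the two derivatives contributes a factor 4, and each boundary edge contributes 4 + 4 = 8,
   so the constant is 16 / 8 = 2. *)
have -> : 2 * 2 ^+ n * X = 2 ^+ n * (4 * (4 * X)) / 8 by field.
by rewrite ler_pdivlMr //; lra.
Qed.

Lemma influence_ln (R : realType) {n} (f : cube n -> spin) (i : 'I_n) :
  - (influence R f i * ln (influence R f i)) <=
  2 * ln 2 * \sum_(S : {set 'I_n} | i \in S) #|S|%:R * fourier R f S ^+ 2.
Proof.
set I := influence R f i; set W := \sum_(_ | _) _; set A := pivotal f i.
have two_gt0 : (0 < 2 ^+ n :> R) by rewrite exprn_gt0.
have ln2 : 0 < ln 2 :> R by rewrite ln_gt0 // ltr1n.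
have cA : #|A|%:R = 2 ^+ n * I := card_pivotal R f i.
have W0 : 0 <= W by apply: sumr_ge0 => S _; rewrite mulr_ge0 // sqr_ge0.
have : 0 <= I by apply: sumr_ge0 => S _; rewrite sqr_ge0.
rewrite le_eqVlt => /orP[/eqP <-|I0]; first by rewrite mul0r oppr0 !mulr_ge0 // ltW.
have iso := edge_isoperimetry R A (index_enum_uniq 'I_n).
have bd : \sum_(j < n) (#|A|%:R - #|inner j A|%:R) <= 2 * 2 ^+ n * W.
  (* Double counting: each [S] containing [i] occurs once for every [j] in [S]. *)
  have -> : W = \sum_(j < n) \sum_(S : {set 'I_n} | (i \in S) && (j \in S)) fourier R f S ^+ 2.
    rewrite (exchange_big_dep (fun S : {set 'I_n} => i \in S)) /=; last by move=> j S _ /andP[].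
    by apply: eq_bigr => S iS; rewrite sumr_const iS mulr_natl.
  rewrite mulr_sumr; apply: ler_sum => j _.
  apply: le_trans (card_pivotal_boundary R f i j).
  have sub : inner j A \subset A by apply/fintype.subsetP => x; rewrite inE => /andP[].
  by rewrite -natrB ?subset_leq_card // cardsD (finset.setIidPr sub).
move: bd; rewrite sumrB sumr_const card_ord -natr_sum -[_ *+ n]mulr_natr cA => bd.
have := ler_wpM2r (ltW ln2) bd.
move: iso; rewrite cA lnM ?posrE // lnXn // -[ln 2 *+ n]mulr_natr => iso bd2.
(* Adding [iso] and [bd2] cancels the inner points, and the term [n * ln 2] of [ln (2 ^+ n * I)]
   cancels the total degree [n]. *)
rewrite -(ler_pM2l two_gt0).
lra.
Qed.

(** * Entropy of a random set bounded by its marginals *)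

Lemma entropy_le_marginals {R : realType} {T : finType} (p : {set T} -> R)
    (I := fun i => \sum_(S : {set T} | i \in S) p S) :
  (forall S, 0 <= p S) -> \sum_S p S = 1 ->
  \sum_S p S * ln (1 / p S) <= \sum_i I i - \sum_i I i * ln (I i).
Proof.
move=> p0 p1; set L := \sum_i I i.
have I0 i : 0 <= I i by apply: sumr_ge0.
pose q (S : {set T}) := expR (- L) * \prod_(i in S) I i.
have q0 S : 0 <= q S by rewrite mulr_ge0 ?expR_ge0 ?prodr_ge0.
(* The sum over subsets factors into the product of the [1 + I i], and [1 + t <= expR t]. *)
have q1 : \sum_S q S <= 1.
  have -> : \sum_S q S = expR (- L) * \prod_i (I i + 1).
    rewrite bigA_distr -mulr_sumr; congr (_ * _); apply: eq_bigr => S _.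
    by rewrite big_mkcond.
  rewrite -(ler_pM2l (expR_gt0 L)) mulrA -expRD subrr expR0 mul1r mulr1 /L expR_sum.
  by apply: ler_prod => i _; rewrite addr_ge0 //= addrC expR_ge1Dx.
(* Gibbs' inequality termwise, from [ln t <= t - 1] at [t = q S / p S]; the corrections [q S - p S]
   have nonpositive sum. *)
have step S : p S * ln (1 / p S) <= p S * (L - \sum_(i in S) ln (I i)) + (q S - p S).
  have := p0 S; rewrite le_eqVlt => /orP[/eqP <-|pS].
    by rewrite !mul0r add0r subr0.
  have Ipos i : i \in S -> 0 < I i.
    move=> iS; apply: lt_le_trans pS _.
    by rewrite /I (bigD1 S) //= lerDl sumr_ge0.
  have qS : 0 < q S by rewrite mulr_gt0 ?expR_gt0 // prodr_gt0.
  have lnq : ln (q S) = - L + \sum_(i in S) ln (I i).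
    rewrite lnM ?posrE ?expR_gt0 ?prodr_gt0 // expRK; congr (_ + _).
    rewrite -[RHS]expRK expR_sum; congr ln.
    by apply: eq_bigr => i iS; rewrite lnK // posrE Ipos.
  have -> : L - \sum_(i in S) ln (I i) = - ln (q S) by rewrite lnq; ring.
  have : ln (q S / p S) <= q S / p S - 1.
    have := @le_ln1Dx R (q S / p S - 1); rewrite subrKC; apply.
    by have := divr_gt0 qS pS; lra.
  rewrite -(ler_pM2l pS) ln_div // div1r lnV // mulrBr mulrBr mulrCA divff ?gt_eqF //.
  by rewrite !mulr1; lra.
have {step} := ler_sum (index_enum {set T}) (fun S (_ : true) => step S).
move=> /le_trans; apply.
rewrite big_split /= sumrB p1.
under eq_bigr do rewrite mulrBr.
rewrite sumrB -mulr_suml p1 mul1r.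
have -> : \sum_S p S * \sum_(i in S) ln (I i) = \sum_i I i * ln (I i).
  under eq_bigr do rewrite mulr_sumr.
  rewrite (exchange_big_dep xpredT) //=; apply: eq_bigr => i _.
  by rewrite /I mulr_suml.
by lra.
Qed.

(** * Expectation over the spectral sample and the final bound *)

Lemma expectation_spectral_sample {R : realType} {n} (f : cube n -> spin) (h : {set 'I_n} -> R) :
  (forall S, 0 <= h S) ->
  ('E_(spectral_sample R f)[h] = (\sum_(S : {set 'I_n}) h S * fourier R f S ^+ 2)%:E)%E.
Proof.
move=> h0; rewrite unlock.
(* Writing [h] as a combination of indicators of singletons reduces the integral to point masses. *)
have hE x : ((h x)%:E = \sum_(S : {set 'I_n}) (h S)%:E * (\1_[set S]%classic x)%:E)%E.
  rewrite (bigD1 x) //= big1 ?adde0.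
    by rewrite indicE mem_set // mule1.
  by move=> S Sx; rewrite indicE memNset ?mule0 //= => xS; rewrite xS eqxx in Sx.
under eq_integral do rewrite hE.
rewrite ge0_integral_sum //.
- rewrite -sumEFin; apply: eq_bigr => S _.
  rewrite ge0_integralZl ?lee_fin //.
  by rewrite integral_indic // setIT EFinM -spectral_sample1.
- by move=> S x _; rewrite mule_ge0 // lee_fin.
Qed.

Theorem theorem5p2p3 (R : realType) :
  exists2 c : R, 0 < c &
    forall (n : nat) (f : cube n -> spin), (0 < n)%N ->
      ((spectral_entropy R f)%:E <=
         c%:E * 'E_(spectral_sample R f)[fun S : {set 'I_n} => (#|S|%:R ^+ 2 : R)%R])%E /\
      (c%:E * 'E_(spectral_sample R f)[fun S : {set 'I_n} => (#|S|%:R ^+ 2 : R)%R] =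
         (c * \sum_(S : {set 'I_n}) #|S|%:R ^+ 2 * fourier R f S ^+ 2)%:E)%E.
Proof.
have ln2 : 0 < ln 2 :> R by rewrite ln_gt0 // ltr1n.
exists (2 + (ln 2)^-1); first by rewrite addr_gt0 // invr_gt0.
move=> n f _; rewrite expectation_spectral_sample; last by move=> S; rewrite sqr_ge0.
split=> //; rewrite lee_fin.
set W := \sum_S _.
have sum_mem (u : {set 'I_n} -> R) : \sum_i \sum_(S : {set 'I_n} | i \in S) u S =
    \sum_(S : {set 'I_n}) #|S|%:R * u S.
  rewrite (exchange_big_dep xpredT) //=; apply: eq_bigr => S _.
  by rewrite sumr_const mulr_natl.
have -> : spectral_entropy R f =
    (\sum_(S : {set 'I_n}) fourier R f S ^+ 2 * ln (1 / fourier R f S ^+ 2)) / ln 2.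
  by rewrite mulr_suml; apply: eq_bigr => S _; rewrite /log2 mulrA.
rewrite ler_pdivrMr //.
apply: le_trans (entropy_le_marginals (fun S => sqr_ge0 (fourier R f S)) (parseval R f)) _.
(* The influences sum to the mean of [#|S|], and [k <= k ^ 2] for natural [k]. *)
have hI : \sum_i influence R f i <= W.
  rewrite sum_mem; apply: ler_sum => S _; rewrite ler_wpM2r ?sqr_ge0 //.
  by rewrite -natrX ler_nat; case: #|S| => // k; rewrite leq_pmulr.
(* Summing over [i] in [S] supplies the second factor [#|S|]. *)
have hE : - \sum_i influence R f i * ln (influence R f i) <= 2 * ln 2 * W.
  rewrite -sumrN; apply: le_trans (ler_sum _ (fun i _ => influence_ln R f i)) _.
  rewrite -mulr_sumr sum_mem le_eqVlt; apply/orP; left; apply/eqP; congr (_ * _).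
  by apply: eq_bigr => S _; rewrite mulrA -expr2.
have -> : (2 + (ln 2)^-1) * W * ln 2 = W + 2 * ln 2 * W by field; rewrite gt_eqF.
exact: lerD.
Qed.
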